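(* Let $T=(t_{ij})_{i,j=1}^3\in\mathcal{A}_{\infty\to1}^{(3)}(\mathbb{R})$ with $\operatorname{rank}(T)=2$. If $T$ is an extreme contraction, i.e. an extreme point of $\mathcal{A}_{\infty\to1}^{(3)}(\mathbb{R})$, then either (i) $t_{12}=t_{13}=t_{23}<0$, or (ii) $|t_{12}|=|t_{13}|=|t_{23}|$ and exactly two of $t_{12},t_{13},t_{23}$ are positive.
   Context: $\mathcal{A}_{\infty\to1}^{(n)}(\mathbb{R})=\{T\in M_n(\mathbb{R}):T\ge0,\ \|T\|_{\infty\to1}\le1\}$, where $T\ge0$ means symmetric non-negative definite and $\|T\|_{\infty\to1}$ is the operator norm of $T:\ell_\infty^n(\mathbb{R})\to\ell_1^n(\mathbb{R})$ with respect to the canonical basis. *)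

(* Defs.v *)
From HB Require Import structures.
From mathcomp Require Import all_boot all_order all_algebra.
From mathcomp Require Import all_classical all_reals all_analysis.

Set Implicit Arguments.
Unset Strict Implicit.
Unset Printing Implicit Defensive.

Import Order.TTheory GRing.Theory Num.Theory.
Import numFieldNormedType.Exports.

Local Open Scope classical_set_scope.
Local Open Scope ring_scope.

Definition psdmx (R : realType) (n : nat) (T : 'M[R]_n) : Prop :=
  T \is symmetricmx /\ forall x : 'cV[R]_n, 0 <= (x^T *m T *m x) 0 0.

Definition l1norm (R : realType) (n : nat) (x : 'cV[R]_n) : R :=
  \sum_(i < n) `|x i 0|.

(* The library's norm [`|x|] on matrices is the maximum of the absolute values
   of the entries, so [`|x| <= 1] is the closed unit ball of l_infty^n.  The
   set below is nonempty and bounded above, so its [sup] is the actual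
   supremum. *)
Definition opnorm_infty_1 (R : realType) (n : nat) (T : 'M[R]_n) : R :=
  sup [set l1norm (T *m x) | x in [set x : 'cV[R]_n | `|x| <= 1]].

Definition A_infty_1 (R : realType) (n : nat) : set 'M[R]_n :=
  [set T | psdmx T /\ opnorm_infty_1 T <= 1].

Arguments A_infty_1 R n : clear implicits.

Definition extreme_point (R : realType) (V : lmodType R) (C : set V) (x : V) :
    Prop :=
  C x /\
  forall (y z : V) (t : R), C y -> C z -> 0 < t -> t < 1 ->
    x = t *: y + (1 - t) *: z -> y = x /\ z = x.

(* Main.v *)
(** For [T >= 0], Cauchy-Schwarz turns [opnorm_infty_1 T <= 1] into [s^T T s <= 1]
for all sign vectors [s].  A symmetric [S] with range inside that of [T] can be
added to [T] in both directions, in small amounts, without leaving the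
nonnegative cone; so at an extreme point no nonzero such [S] is annihilated by
all the active constraints.  When [T] has rank 2 these [S] form a space of
dimension 3, so at least three of the four constraints (sign vectors up to a
global sign) are active.  All four cannot be: [T] would then be diagonal, and an
extreme diagonal matrix has rank at most 1.  Three equalities and one strict
inequality between the four forms give the sign patterns. *)
Require Import Defs.
From HB Require Import structures.
From mathcomp Require Import all_boot all_order all_algebra.
From mathcomp Require Import all_classical all_reals all_analysis.
From mathcomp Require Import ring lra.

Set Implicit Arguments.
Unset Strict Implicit.
Unset Printing Implicit Defensive.

Import Order.TTheory GRing.Theory Num.Theory.
Import numFieldNormedType.Exports.

Local Open Scope classical_set_scope.
Local Open Scope ring_scope.

(** * Bilinear forms and perturbation inside the nonnegative cone *)

Lemma symmetricmxP (R : realType) n (T : 'M[R]_n) :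
  reflect (T^T = T) (T \is symmetricmx).
Proof.
rewrite is_hermitianmxE expr0 scale1r map_mx_id_in // eq_sym.
exact: eqP.
Qed.

Section QuadraticForms.
Context {R : realType} {n : nat}.
Implicit Types (T S Y : 'M[R]_n) (x y : 'cV[R]_n) (t : R).

Definition bil T x y : R := (x^T *m T *m y) 0 0.

Lemma bilE T x y : bil T x y = \sum_i \sum_j x i 0 * T i j * y j 0.
Proof.
rewrite /bil !mxE exchange_big /=; apply: eq_bigr => j _.
by rewrite !mxE mulr_suml; apply: eq_bigr => i _; rewrite !mxE.
Qed.

Lemma bil_mulmx T x y : bil T x y = \sum_i x i 0 * (T *m y) i 0.
Proof. by rewrite /bil -mulmxA !mxE; apply: eq_bigr => i _; rewrite !mxE. Qed.

Lemma bilC T x y : T \is symmetricmx -> bil T x y = bil T y x.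
Proof.
move=> /symmetricmxP sT; rewrite !bilE exchange_big /=.
apply: eq_bigr => i _; apply: eq_bigr => j _.
by rewrite -{2}sT !mxE; ring.
Qed.

Lemma bilDl T x y z : bil T (x + y) z = bil T x z + bil T y z.
Proof. by rewrite /bil linearD /= !mulmxDl mxE. Qed.

Lemma bilDr T x y z : bil T z (x + y) = bil T z x + bil T z y.
Proof. by rewrite /bil !mulmxDr mxE. Qed.

Lemma bilZl T t x y : bil T (t *: x) y = t * bil T x y.
Proof. by rewrite /bil linearZ /= -!scalemxAl mxE. Qed.

Lemma bilZr T t x y : bil T x (t *: y) = t * bil T x y.
Proof. by rewrite /bil -!scalemxAr mxE. Qed.

Lemma bil_addmx T S x y : bil (T + S) x y = bil T x y + bil S x y.
Proof. by rewrite /bil mulmxDr mulmxDl mxE. Qed.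

Lemma bil_scalemx t T x y : bil (t *: T) x y = t * bil T x y.
Proof. by rewrite /bil -scalemxAr -scalemxAl mxE. Qed.

Lemma bil_amgm T x y : psdmx T -> 2 * bil T x y <= bil T x x + bil T y y.
Proof.
move=> [sT pT]; have := pT (x + (-1) *: y); rewrite -/(bil _ _ _).
rewrite !(bilDl, bilDr, bilZl, bilZr) (bilC y x sT); lra.
Qed.

(* Cauchy-Schwarz gives the constant [T i i]; the weaker [1 + T i i] is positive,
   which avoids a case distinction. *)
Lemma psdmx_entry_bound T x i : psdmx T ->
  ((T *m x) i 0) ^+ 2 <= (1 + T i i) * bil T x x.
Proof.
move=> [sT pT].
have bi y : bil T (delta_mx i 0) y = (T *m y) i 0.
  by rewrite /bil trmx_delta -mulmxA -rowE !mxE.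
have C0 : bil T (delta_mx i 0) (delta_mx i 0) = T i i.
  by rewrite bi -colE mxE.
(* With the letters set below, the form at this vector is [(1 + C) ^+ 2 * A - (2 + C) * B ^+ 2], and
   [2 + C] exceeds [1 + C]. *)
have := pT ((1 + T i i) *: x + (- (T *m x) i 0) *: delta_mx i 0).
have := pT (delta_mx i 0); rewrite -!/(bil _ _ _) C0.
rewrite !(bilDl, bilDr, bilZl, bilZr) (bilC x _ sT) C0 bi.
set B := (T *m x) i 0; set A := bil T x x; set C := T i i => C_ge0 H.
rewrite -(ler_pM2l (_ : 0 < 1 + C)); last lra.
have : 0 <= B ^+ 2 by exact: sqr_ge0.
nra.
Qed.

(* [S] is supported on the range of [T], so [S = T Y T] for some [Y]; then
   [x^T S x = (T x)^T Y (T x)] is controlled by [x^T T x]. *)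
Lemma sub_bil_bound T S : psdmx T -> S \is symmetricmx -> (S <= T)%MS ->
  exists2 K, 0 <= K & forall x, `|bil S x x| <= K * bil T x x.
Proof.
move=> pT /symmetricmxP sS leST.
have /symmetricmxP sT := pT.1.
(* [pinvmx T *m T] acts as the identity on the row space of [T], hence on [S]; transposing, with [S]
   and [T] symmetric, gives the same on the left. *)
pose Y := (pinvmx T)^T *m S *m pinvmx T.
have SPT : S *m pinvmx T *m T = S by exact: mulmxKpV.
have SE : S = T *m Y *m T.
  have -> : T *m Y *m T = T *m (pinvmx T)^T *m (S *m pinvmx T *m T).
    by rewrite /Y !mulmxA.
  by rewrite SPT -[LHS]sS -{1}SPT !trmx_mul sS sT mulmxA.
have c_ge0 i : 0 <= T i i.
  have := pT.2 (delta_mx i 0).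
  by rewrite trmx_delta -mulmxA -colE -rowE !mxE.
(* The product of two entries of [T *m x] is at most the sum of their squares, and
   [psdmx_entry_bound] applies to each square. *)
exists (\sum_i \sum_j `|Y i j| * ((1 + T i i) + (1 + T j j))).
  apply: sumr_ge0 => i _; apply: sumr_ge0 => j _.
  by rewrite mulr_ge0 // !addr_ge0.
move=> x; set q := bil T x x.
have -> : bil S x x = bil Y (T *m x) (T *m x).
  by rewrite SE /bil trmx_mul sT !mulmxA.
rewrite bilE mulr_suml (le_trans (ler_norm_sum _ _ _)) //; apply: ler_sum => i _.
rewrite mulr_suml (le_trans (ler_norm_sum _ _ _)) //; apply: ler_sum => j _.
rewrite !normrM [`|_| * `|Y i j|]mulrC -!mulrA ler_wpM2l //.
have := psdmx_entry_bound x i pT; have := psdmx_entry_bound x j pT.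
rewrite -/q -(real_normK (num_real ((T *m x) i 0))).
rewrite -(real_normK (num_real ((T *m x) j 0))).
move: (normr_ge0 ((T *m x) i 0)) (normr_ge0 ((T *m x) j 0)); nra.
Qed.

(** With [K] from [sub_bil_bound], the form of [t *: S] is dominated by that of [T] as soon as
    [|t| * (K + 1) <= 1]. *)
Lemma psdmx_perturb T S : psdmx T -> S \is symmetricmx -> (S <= T)%MS ->
  \forall t \near 0, psdmx (T + t *: S).
Proof.
move=> pT sS leST; have [K K_ge0 bK] := sub_bil_bound pT sS leST.
have K1 : 0 < (K + 1)^-1 by rewrite invr_gt0; lra.
near=> t; split.
  apply/symmetricmxP; rewrite linearD linearZ /=.
  by rewrite (symmetricmxP _ pT.1) (symmetricmxP _ sS).
move=> x; rewrite -/(bil _ x x) bil_addmx bil_scalemx.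
have tK : `|t| * (K + 1) <= 1.
  rewrite -ler_pdivlMr ?mul1r; last lra.
  by near: t; apply: (@nbhs0_le R R^o).
have := bK x; have := pT.2 x; rewrite -/(bil T x x) => T0 SK.
have : `|t * bil S x x| <= bil T x x.
  rewrite normrM; apply: le_trans (ler_wpM2l (normr_ge0 t) SK) _.
  rewrite mulrA; apply: ler_piMl => //.
  apply: le_trans tK; apply: ler_wpM2l => //; lra.
rewrite ler_norml; lra.
Unshelve. all: by end_near. Qed.

(** * Sign vectors as the constraints behind the norm bound *)

Definition sgnv (b : {ffun 'I_n -> bool}) : 'cV[R]_n := \col_i (-1) ^+ b i.

Lemma mx_norm_le1P x : reflect (forall i, `|x i 0| <= 1) (`|x| <= 1).
Proof.
rewrite [`|x|]mx_normrE; apply: (iffP idP) => [x1 i|x1].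
  exact: le_trans (le_bigmax _ (fun ij => `|x ij.1 ij.2|) (i, 0)) x1.
by apply: bigmax_le => // -[i j] _; rewrite ord1.
Qed.

Lemma sgnv_norm_le1 b : `|sgnv b| <= 1.
Proof. by apply/mx_norm_le1P => i; rewrite mxE normrX normrN1 expr1n. Qed.

Lemma sgnvP x : exists b, forall i, sgnv b i 0 * x i 0 = `|x i 0|.
Proof.
exists [ffun i => x i 0 < 0] => i; rewrite !mxE ffunE.
by rewrite normrEsign ?num_real.
Qed.

Lemma l1norm_sgnv T x : exists b, l1norm (T *m x) = bil T (sgnv b) x.
Proof.
have [b bE] := sgnvP (T *m x); exists b.
by rewrite bil_mulmx; apply: eq_bigr => i _; rewrite bE.
Qed.

Lemma bil_le_l1norm T x b : bil T (sgnv b) x <= l1norm (T *m x).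
Proof.
rewrite bil_mulmx; apply: ler_sum => i _.
by rewrite (le_trans (ler_norm _)) // normrM mxE normrX normrN1 expr1n mul1r.
Qed.

(** For [s] the sign vector of [T x], symmetry turns the norm of [T x] into [x^T T s], where each
    entry of [x] has modulus at most 1. *)
Lemma l1norm_le_sgnv T x : T \is symmetricmx -> `|x| <= 1 ->
  exists b, l1norm (T *m x) <= l1norm (T *m sgnv b).
Proof.
move=> sT /mx_norm_le1P x1; have [b ->] := l1norm_sgnv T x; exists b.
rewrite bilC // bil_mulmx; apply: ler_sum => i _.
by rewrite (le_trans (ler_norm _)) // normrM ler_piMl.
Qed.

(** Sign vectors suffice on both sides of the form, and [bil_amgm] bounds a mixed value by the mean
    of two diagonal ones. *)
Lemma opnorm_le1P T : psdmx T ->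
  opnorm_infty_1 T <= 1 <-> forall b, bil T (sgnv b) (sgnv b) <= 1.
Proof.
move=> pT; split=> [T1 b|T1].
  apply: le_trans (bil_le_l1norm _ _ _) _; apply: le_trans T1.
  apply: ub_le_sup; last by exists (sgnv b) => //; exact: sgnv_norm_le1.
  (* A crude bound, which only certifies that the set under [sup] is bounded above. *)
  exists (\sum_b l1norm (T *m sgnv b)) => _ [x /= x1 <-].
  have [c Tc] := l1norm_le_sgnv pT.1 x1; apply: le_trans Tc _.
  rewrite (bigD1 c) //= lerDl; apply: sumr_ge0 => d _.
  exact: sumr_ge0.
apply: ge_sup.
  by exists (l1norm (T *m 0)), 0 => //=; rewrite normr0.
move=> _ [x /= x1 <-].
have [b Tb] := l1norm_le_sgnv pT.1 x1; apply: le_trans Tb _.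
have [c ->] := l1norm_sgnv T (sgnv b).
have := bil_amgm (sgnv c) (sgnv b) pT; have := T1 b; have := T1 c; lra.
Qed.

(** Active constraints do not change along [S] and inactive ones have slack, so [T] is the midpoint
    of [T + t S] and [T - t S], both in the set for small [t]. *)
Lemma extreme_perturb_eq0 T S : extreme_point (A_infty_1 R n) T ->
    S \is symmetricmx -> (S <= T)%MS ->
    (forall b, bil T (sgnv b) (sgnv b) = 1 -> bil S (sgnv b) (sgnv b) = 0) ->
  S = 0.
Proof.
move=> [[pT T1] xT] sS leST act; have {}T1 := (opnorm_le1P pT).1 T1.
have AT : \forall t \near (0 : R), A_infty_1 R n (T + t *: S).
  have sgn1 : \forall t \near (0 : R), forall b,
      bil (T + t *: S) (sgnv b) (sgnv b) <= 1.
    (* There are finitely many sign vectors, so a neighborhood for each one is enough. *)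
    apply: (@filter_forall _ _ _ _ (nbhs_filter (0 : R))) => b.
    have := T1 b; rewrite le_eqVlt => /orP[/eqP Tb|Tb].
      apply: nearW => t.
      by rewrite bil_addmx bil_scalemx act // mulr0 addr0 Tb.
    pose k := `|bil S (sgnv b) (sgnv b)| + 1.
    have k0 : 0 < k by rewrite ltr_wpDl.
    near=> t; rewrite bil_addmx bil_scalemx.
    have tk : `|t| <= (1 - bil T (sgnv b) (sgnv b)) / k.
      by near: t; apply: (@nbhs0_le R R^o); rewrite divr_gt0 // subr_gt0.
    rewrite -lerBrDl (le_trans (ler_norm _)) // normrM.
    rewrite ler_pdivlMr // in tk; apply: le_trans tk.
    by apply: ler_wpM2l => //; rewrite lerDl.
  near=> t; have pTt : psdmx (T + t *: S).
    by near: t; exact: psdmx_perturb.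
  split=> //; apply/opnorm_le1P => // b; move: b; near: t; exact: sgn1.
have /nbhs_ballP[e /= e0 ATe] := AT.
pose t := e / 2; have t0 : 0 < t by rewrite divr_gt0.
have te : t < e by rewrite ltr_pdivrMr // ltr_pMr // ltr1n.
have Ap : A_infty_1 R n (T + t *: S).
  by apply: ATe; rewrite /ball /= sub0r normrN gtr0_norm.
have Am : A_infty_1 R n (T + (- t) *: S).
  by apply: ATe; rewrite /ball /= sub0r opprK gtr0_norm.
have [] := xT _ _ (2^-1) Ap Am.
- by rewrite invr_gt0.
- by rewrite invf_lt1 // ltr1n.
- rewrite (_ : 1 - 2^-1 = 2^-1 :> R); last by lra.
  rewrite -scalerDr scaleNr addrACA subrr addr0.
  by rewrite scalerDr -scalerDl (_ : _ + _ = 1 :> R) ?scale1r //; lra.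
move=> /eqP; rewrite -subr_eq0 addrAC subrr add0r scaler_eq0 gt_eqF //=.
by move/eqP.
Unshelve. all: by end_near. Qed.

(** * Extreme diagonal matrices *)

Lemma bil_diag_sgnv (d : 'rV[R]_n) b :
  bil (diag_mx d) (sgnv b) (sgnv b) = \sum_i d 0 i.
Proof.
rewrite bil_mulmx; apply: eq_bigr => i _.
by rewrite mul_diag_mx !mxE mulrCA -expr2 sqrr_sign mulr1.
Qed.

Lemma extreme_diag_rank (d : 'rV[R]_n) :
  extreme_point (A_infty_1 R n) (diag_mx d) -> (\rank (diag_mx d) <= 1)%N.
Proof.
move=> xd.
have d0 i j : i != j -> d 0 i * d 0 j = 0.
  (* The perturbation [h] has entries [d_i d_j] at [i] and [- d_i d_j] at [j]: its trace vanishes,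
     and with it the form at every sign vector. *)
  move=> ij; pose e : 'rV[R]_n := \row_k
    ((k == i)%:R * d 0 j - (k == j)%:R * d 0 i).
  pose h : 'rV[R]_n := \row_k (e 0 k * d 0 k).
  have /(extreme_perturb_eq0 xd) : diag_mx h \is symmetricmx.
    by apply/symmetricmxP; rewrite tr_diag_mx.
  have hE : diag_mx h = diag_mx e *m diag_mx d by rewrite mulmx_diag.
  have -> : (diag_mx h <= diag_mx d)%MS by rewrite hE submxMl.
  move=> /(_ isT) H; have /H h0 b : bil (diag_mx d) (sgnv b) (sgnv b) = 1 ->
      bil (diag_mx h) (sgnv b) (sgnv b) = 0.
    move=> _; rewrite bil_diag_sgnv (bigD1 i) //= (bigD1 j) 1?eq_sym //=.
    rewrite big1 => [|k /andP[/negPf ki /negPf kj]]; rewrite !mxE.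
      rewrite !eqxx (eq_sym j i) (negPf ij) !mul1r !mul0r subr0.
      by rewrite sub0r addr0 mulNr mulrC subrr.
    by rewrite ki kj !mul0r subr0 mul0r.
  have := congr1 (fun M : 'M[R]_n => M i i) h0; rewrite !mxE !eqxx (negPf ij).
  by rewrite mul1r mul0r subr0 mulr1n mulrC.
have [/existsP[i di]|] := boolP [exists i, d 0 i != 0].
  have -> : diag_mx d = d 0 i *: delta_mx i i.
    apply/matrixP => k l; rewrite !mxE.
    have [<-|kl] := eqVneq k l; last first.
      have [ki|_] := eqVneq k i; last by rewrite /= mulr0.
      by rewrite -ki [l == k]eq_sym (negPf kl) /= mulr0.
    have [->|ki] := eqVneq k i; first by rewrite mulr1 mulr1n.
    have /eqP := d0 _ _ ki; rewrite mulf_eq0 (negPf di) orbF => /eqP ->.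
    by rewrite mulr0.
  by rewrite (leq_trans (mxrankS (scalemx_sub _ (submx_refl _)))) ?mxrank_delta.
rewrite negb_exists => /forallP d00.
suff -> : d = 0 by rewrite linear0 mxrank0.
by apply/rowP => i; rewrite mxE; apply/eqP; have := d00 i; rewrite negbK.
Qed.

End QuadraticForms.

(** * Symmetric matrices supported on a range of dimension 2 *)

Lemma rank2_sym_sub (R : realType) n (T : 'M[R]_n) (x y : 'cV[R]_n) : \rank T = 2%N ->
  exists S, [/\ S \is symmetricmx, (S <= T)%MS, S != 0,
                bil S x x = 0 & bil S y y = 0].
Proof.
move=> rT; have [B fB BT] : exists2 B : 'M[R]_(2, n), row_free B & (B <= T)%MS.
  have : (row_base T <= T)%MS by rewrite eq_row_base.
  by move: (row_base T) (row_base_free T); rewrite rT => B; exists B.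
(* A symmetric matrix of order 2 has three free entries, so two linear conditions leave a nonzero
   one, which [B] carries to [B^T M B]. *)
have quad_ker (u w : 'cV[R]_2) : exists2 M : 'M[R]_2, M^T = M /\ M != 0 &
    bil M u u = 0 /\ bil M w w = 0.
  pose c (z : 'cV[R]_2) : 'cV[R]_3 := \col_k
    nth 0 [:: z 0 0 ^+ 2; 2 * z 0 0 * z 1 0; z 1 0 ^+ 2] k.
  have [v /sub_kermxP v_ker v0] : exists2 v : 'rV_3,
      (v <= kermx (row_mx (c u) (c w)))%MS & v != 0.
    apply/rowV0Pn; rewrite -mxrank_eq0 mxrank_ker subn_eq0 -ltnNge ltnS.
    exact: rank_leq_col.
  have [cu cw] : v *m c u = 0 /\ v *m c w = 0.
    by apply/eq_row_mx; rewrite -mul_mx_row v_ker row_mx0.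
  (* A Hankel matrix, so that [z^T M z = v *m c z]. *)
  pose M : 'M[R]_2 := \matrix_(i, j) v 0 (inord (i + j)).
  have i1 : lift ord0 ord0 = inord 1 :> 'I_3 by apply/val_inj; rewrite /= inordK.
  have i2 : lift ord0 (lift ord0 ord0) = inord 2 :> 'I_3.
    by apply/val_inj; rewrite /= inordK.
  have i0 : inord 0 = 0 :> 'I_3 by apply/val_inj; rewrite /= inordK.
  have j1 : lift ord0 ord0 = 1 :> 'I_2 by apply/val_inj.
  have bilM z : bil M z z = (v *m c z) 0 0.
    rewrite bilE !mxE !big_ord_recl !big_ord0 !mxE /= i1 i2 i0 j1; ring.
  exists M; last by rewrite !bilM cu cw mxE.
  split; first by apply/matrixP => i j; rewrite !mxE addnC.
  apply: contraNneq v0 => /matrixP M0; apply/eqP/rowP => k; rewrite mxE.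
  have := M0 0 0; have := M0 0 1; have := M0 1 1; rewrite !mxE.
  have -> : k = inord k by rewrite inord_val.
  by case: k => -[|[|[|]]].
have [M [sM M0] [Mx My]] := quad_ker (B *m x) (B *m y).
have sS : (B^T *m M *m B)^T = B^T *m M *m B.
  by rewrite !trmx_mul trmxK sM mulmxA.
exists (B^T *m M *m B); split.
- exact/symmetricmxP.
- exact: submx_trans (submxMl _ _) BT.
- by rewrite mulmx_free_eq0 // -trmx_eq0 trmx_mul trmxK mulmx_free_eq0 // trmx_eq0.
- by rewrite -Mx /bil trmx_mul !mulmxA.
- by rewrite -My /bil trmx_mul !mulmxA.
Qed.

(** * The four sign patterns in order 3 *)

(* Up to a global sign, the sign vectors of length 3 are [(1, (-1)^p, (-1)^q)]. *)
Definition sgn_form (R : realType) (T : 'M[R]_3) (k : bool * bool) : R :=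
  T 0 0 + T 1 1 + T 2 2 + 2 * ((-1) ^+ k.1 * T 0 1 + (-1) ^+ k.2 * T 0 2
    + (-1) ^+ (k.1 (+) k.2) * T 1 2).

Lemma bil_sgnv3 (R : realType) (T : 'M[R]_3) (b : {ffun 'I_3 -> bool}) :
  T \is symmetricmx ->
  bil T (sgnv b) (sgnv b) = sgn_form T (b 0 (+) b 1, b 0 (+) b 2).
Proof.
move=> /symmetricmxP sT.
have i1 : lift ord0 ord0 = 1 :> 'I_3 by apply/val_inj.
have i2 : lift ord0 (lift ord0 ord0) = 2 :> 'I_3 by apply/val_inj.
have sE i j : T i j = T j i by rewrite -{1}sT mxE.
rewrite bilE !big_ord_recl !big_ord0 !mxE i1 i2 /sgn_form /=.
rewrite -/(0 : 'I_3) (sE 1 0) (sE 2 0) (sE 2 1).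
by case: (b 0); case: (b 1); case: (b 2); rewrite /= ?expr0 ?expr1; ring.
Qed.

Lemma sgn_vec3 (k : bool * bool) : exists b : {ffun 'I_3 -> bool},
  k = (b 0 (+) b 1, b 0 (+) b 2).
Proof.
exists [ffun i : 'I_3 => nth false [:: false; k.1; k.2] i].
by rewrite !ffunE /=; case: k.
Qed.

(** Avoiding any two given patterns encodes that at least three are active. Otherwise the matrix of
    [rank2_sym_sub] for these two would contradict extremality. *)
Lemma rank2_active (R : realType) (T : 'M[R]_3) k1 k2 :
  extreme_point (A_infty_1 R 3) T -> \rank T = 2%N ->
  exists k, [/\ k != k1, k != k2 & sgn_form T k = 1].
Proof.
move=> xT rT; have sT := xT.1.1.1.
have [[k /and3P[? ? /eqP]]|] := pselect (exists k,
  [&& k != k1, k != k2 & sgn_form T k == 1]); first by exists k.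
move=> noact; have [b1 b1E] := sgn_vec3 k1; have [b2 b2E] := sgn_vec3 k2.
have [S [sS ST S0 S1 S2]] := rank2_sym_sub (sgnv b1) (sgnv b2) rT.
rewrite !bil_sgnv3 // -b1E -b2E in S1 S2; case/negP: S0; apply/eqP.
apply: (extreme_perturb_eq0 xT) => // b; rewrite !bil_sgnv3 // => act.
have [->//|kk1] := eqVneq (b 0 (+) b 1, b 0 (+) b 2) k1.
have [->//|kk2] := eqVneq (b 0 (+) b 1, b 0 (+) b 2) k2.
by case: noact; exists (b 0 (+) b 1, b 0 (+) b 2); rewrite kk1 kk2 act eqxx.
Qed.

(** Four equalities would make every off-diagonal entry vanish, against [extreme_diag_rank]. *)
Lemma rank2_inactive (R : realType) (T : 'M[R]_3) :
  extreme_point (A_infty_1 R 3) T -> \rank T = 2%N ->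
  exists k, sgn_form T k != 1.
Proof.
move=> xT rT; have [//|/forallNP act] := pselect (exists k, sgn_form T k != 1).
have {}act k : sgn_form T k = 1 by apply/eqP/negbNE/negP; exact: act.
have := (act (false, false), act (false, true), act (true, false), act (true, true)).
rewrite /sgn_form /= !expr0 !expr1 => -[[[a0 a1] a2] a3].
have T01 : T 0 1 = 0 by lra.
have T02 : T 0 2 = 0 by lra.
have T12 : T 1 2 = 0 by lra.
have /symmetricmxP sT := xT.1.1.1.
have sE i j : T i j = T j i by rewrite -{1}sT mxE.
have TD : T = diag_mx (\row_i T i i).
  apply/matrixP => i j; rewrite !mxE; have [->|ij] := eqVneq i j.
    by rewrite mulr1n.
  have I3 (k : 'I_3) : [\/ k = 0, k = 1 | k = 2].
    by case: k => -[|[|[|//]]] ?; [constructor 1|constructor 2|constructor 3];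
      apply/val_inj.
  rewrite mulr0n; move: ij.
  by case: (I3 i) => ->; case: (I3 j) => -> //; rewrite ?eqxx // => _;
    rewrite // sE.
by have := extreme_diag_rank (d := \row_i T i i); rewrite -TD rT => /(_ xT).
Qed.

Theorem theorem2p20 (R : realType) (T : 'M[R]_3)
    (hT : A_infty_1 R 3 T)
    (hrank : \rank T = 2%N)
    (hext : extreme_point (A_infty_1 R 3) T) :
  [/\ T 0 1 = T 0 2, T 0 2 = T 1 2 & T 1 2 < 0]
  \/
  [/\ `|T 0 1| = `|T 0 2|, `|T 0 2| = `|T 1 2| &
      count (fun t : R => 0 < t) [:: T 0 1; T 0 2; T 1 2] = 2%N].
Proof.
have le1 k : sgn_form T k <= 1.
  have [b ->] := sgn_vec3 k.
  rewrite -bil_sgnv3; last exact: hT.1.1.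
  exact: (opnorm_le1P hT.1).1 hT.2 b.
have [k0 k0N1] := rank2_inactive hext hrank.
have act k : k != k0 -> sgn_form T k = 1.
  move=> kk0; have [a [b abP]] : exists a b, forall l : bool * bool,
      [|| l == a, l == b, l == k | l == k0].
    (* In the group of patterns under xor, let [d] be the nonzero difference of [k] and [k0]. Then
       [a] is [k0] shifted by [(d.2, d.1 (+) d.2)], which is neither zero nor [d], and the other
       witness is [a] shifted by [d]. *)
    pose a := (k0.1 (+) (k.2 (+) k0.2), k0.1 (+) k.1 (+) k.2).
    exists a, (a.1 (+) (k.1 (+) k0.1), a.2 (+) (k.2 (+) k0.2)).
    rewrite /a; move: k0 k kk0 {k0N1 a} => [[] []] [[] []] // _ [[] []] //.
  have [l [la lb lT]] := rank2_active a b hext hrank.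
  have := abP l; rewrite (negPf la) (negPf lb) /= => /orP[/eqP <-//|/eqP l0].
  by rewrite -l0 lT eqxx in k0N1.
have lt1 : sgn_form T k0 < 1 by rewrite lt_neqAle k0N1 le1.
(* The three equalities make the off-diagonal entries agree up to sign, and the strict inequality at
   [k0] fixes the signs; [k0 = (false, false)] is the case of equal negative entries. *)
have := (act (false, false), act (false, true), act (true, false), act (true, true)).
move: k0 lt1 {act k0N1} => [[] []]; rewrite /sgn_form /= ?expr0 ?expr1.
- move=> lt1 [[[/(_ isT) a0 /(_ isT) a1] /(_ isT) a2] _]; right.
  have x0 : T 1 2 < 0 by lra.
  have -> : T 0 1 = - T 1 2 by lra.
  have -> : T 0 2 = - T 1 2 by lra.
  by rewrite /= !normrN !oppr_gt0 x0 ltNge (ltW x0).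
- move=> lt1 [[[/(_ isT) a0 /(_ isT) a1] _] /(_ isT) a3]; right.
  have x0 : T 0 2 < 0 by lra.
  have -> : T 0 1 = - T 0 2 by lra.
  have -> : T 1 2 = - T 0 2 by lra.
  by rewrite /= !normrN !oppr_gt0 x0 ltNge (ltW x0).
- move=> lt1 [[[/(_ isT) a0 _] /(_ isT) a2] /(_ isT) a3]; right.
  have x0 : T 0 1 < 0 by lra.
  have -> : T 0 2 = - T 0 1 by lra.
  have -> : T 1 2 = - T 0 1 by lra.
  by rewrite /= !normrN !oppr_gt0 x0 ltNge (ltW x0).
- move=> lt1 [[[_ /(_ isT) a1] /(_ isT) a2] /(_ isT) a3]; left.
  by split; lra.
Qed.
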